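(* Let $K$ be a differential field of characteristic zero, let $u_1,\ldots,u_n\in K\{x_1,\ldots,x_n\}$, and let $\Sigma=\operatorname{Spec}\big(K\{x_1,\ldots,x_n\}/[u_1,\ldots,u_n]\big)$. Let $\Sigma_1$ be an irreducible component of $\Sigma$ with $\dim(\Sigma_1)<\infty$, and let $\eta_1$ be the generic point of $\Sigma_1$. If $\dim\big((T\Sigma)_{\eta_1}\big)>\dim(\Sigma_1)$, then $\Sigma_1$ is not generically reduced.
   Context: $K\{x_1,\ldots,x_n\}=K[x_i^{(r)}: 1\le i\le n,\ r\ge 0]$ is the ring of differential polynomials, with the derivation extending that of $K$ and $\partial x_i^{(r)}=x_i^{(r+1)}$. $[u_1,\ldots,u_n]$ is the ideal generated by all $\partial^j(u_i)$, $1\le i\le n$, $j\ge 0$. Write $A=K\{x_1,\ldots,x_n\}/[u_1,\ldots,u_n]$. An irreducible component $\Sigma_1$ of $\Sigma=\operatorname{Spec}A$ corresponds to a minimal prime $P$ of $A$ (its generic point $\eta_1$); as a scheme it is $\operatorname{Spec}(A/Q)$ with $Q=\ker(A\to A_P)$. It is generically reduced if the local ring $A_P$ is reduced. $\dim(\Sigma_1)=\operatorname{trdeg}_K\kappa(P)$, where $\kappa(P)=\operatorname{Frac}(A/P)$. The tangent bundle is $\pi:T\Sigma=\operatorname{Spec}(\operatorname{Sym}_A(\Omega_{A/K}))\to\Sigma$, where $\Omega_{A/K}$ is the module of ordinary Kähler differentials (of $A$ as a $K$-algebra), and $(T\Sigma)_{\eta_1}=\pi^{-1}(\eta_1)=\operatorname{Spec}\operatorname{Sym}_{\kappa(\eta_1)}(\Omega_{A/K}\otimes_A\kappa(\eta_1))$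 is the fiber over $\eta_1$. Its dimension is taken as a scheme over $\kappa(\eta_1)$ (transcendence degree of its function field over $\kappa(\eta_1)$, possibly infinite). *)

(* Defs.v *)
From HB Require Import structures.
From mathcomp Require Import all_boot all_order all_algebra finmap ring zify.
From mathcomp Require Import generic_quotient ring_quotient fraction.
From mathcomp.multinomials Require Import monalg.
From mathcomp Require Import boolp classical_sets topology.

Set Implicit Arguments.
Unset Strict Implicit.
Unset Printing Implicit Defensive.

Import GRing.Theory.

Local Open Scope fset_scope.
Local Open Scope classical_set_scope.
Local Open Scope quotient_scope.
Local Open Scope ring_scope.

(* Rings are comPzRingType, so that the quotient by an ideal containing 1 is
   allowed. *)

Section Ideals.
Variable R : comPzRingType.

Definition is_ideal (I : set R) : Prop :=
  I 0 /\ forall a x y, I x -> I y -> I (a * x + y).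

Definition is_prime (P : set R) : Prop :=
  [/\ is_ideal P, ~ P 1 & forall x y, P (x * y) -> P x \/ P y].

Definition ideal_gen (S : set R) : set R := smallest is_ideal S.

Lemma ideal_gen_is_ideal (S : set R) : is_ideal (ideal_gen S).
Proof.
split=> [I [[I0 _] _] // | a x y Ix Iy I [idI sSI]].
by apply: idI.2; [apply: Ix | apply: Iy].
Qed.

Lemma ideal_gen_id (I : set R) : is_ideal I -> ideal_gen I = I.
Proof.
move=> idI; apply/seteqP; split; first exact: smallest_sub.
exact: sub_gen_smallest.
Qed.

Definition ideal_gen_pred (S : set R) : R -> bool := fun x => `[< ideal_gen S x >].

Lemma ideal_gen_zmod_closed (S : set R) : zmod_closed (ideal_gen_pred S).
Proof.
have [I0 IP] := ideal_gen_is_ideal S.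
split=> [|x y /asboolP Ix /asboolP Iy]; apply/asboolP => //.
by rewrite addrC -mulN1r; apply: IP.
Qed.

HB.instance Definition _ (S : set R) :=
  GRing.isZmodClosed.Build R (ideal_gen_pred S) (ideal_gen_zmod_closed S).

Definition ideal_gen_zmod (S : set R) : zmodClosed R :=
  GRing.ZmodClosed.clone R (ideal_gen_pred S) _.

End Ideals.

(* The quotient R / (S) of R by the ideal generated by S. *)
Section QuotientRing.
Variables (R : comPzRingType) (S : set R).

Definition quotring := Quotient.quot (ideal_gen_zmod S).

HB.instance Definition _ := GRing.Zmodule.on quotring.

Definition to_quotring (x : R) : quotring := \pi_(Quotient.quot (ideal_gen_zmod S)) x.

Lemma to_quotring_eq x y : to_quotring x = to_quotring y <-> ideal_gen S (x - y).
Proof.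
rewrite /to_quotring; split=> [/eqP | h].
  by rewrite -Quotient.idealrBE => /asboolP.
by apply/eqP; rewrite -Quotient.idealrBE; apply/asboolP.
Qed.

Definition quotring_repr (x : quotring) : R := repr x.

Lemma quotring_reprK : cancel quotring_repr to_quotring.
Proof. by move=> x; rewrite /to_quotring reprK. Qed.

Lemma to_quotring_surj (x : quotring) : exists a, x = to_quotring a.
Proof. by exists (quotring_repr x); rewrite quotring_reprK. Qed.

Lemma to_quotring_is_zmod_morphism : zmod_morphism to_quotring.
Proof. by move=> x y; rewrite /to_quotring raddfB. Qed.

HB.instance Definition _ :=
  GRing.isZmodMorphism.Build R quotring to_quotring to_quotring_is_zmod_morphism.

Definition quotring_one : quotring := to_quotring 1.

Definition quotring_mul (x y : quotring) : quotring :=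
  to_quotring (quotring_repr x * quotring_repr y).

Lemma to_quotringM x y :
  to_quotring (x * y) = quotring_mul (to_quotring x) (to_quotring y).
Proof.
have [I0 IP] := ideal_gen_is_ideal S.
have e z : ideal_gen S (z - quotring_repr (to_quotring z)).
  by apply/to_quotring_eq; rewrite quotring_reprK.
apply/to_quotring_eq; set x' := quotring_repr _; set y' := quotring_repr _.
rewrite (_ : _ - _ = y * (x - x') + (x' * (y - y') + 0)).
  exact: IP (e x) (IP _ _ _ (e y) I0).
by rewrite addr0 !mulrBr (mulrC y x) (mulrC y x') addrA subrK.
Qed.

Lemma quotring_mulA : associative quotring_mul.
Proof.
move=> x y z; have [[[a ->] [b ->]] [c ->]] :=
  (to_quotring_surj x, to_quotring_surj y, to_quotring_surj z).
by rewrite -!to_quotringM mulrA.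
Qed.

Lemma quotring_mulC : commutative quotring_mul.
Proof. by move=> x y; rewrite /quotring_mul mulrC. Qed.

Lemma quotring_mul1 : left_id quotring_one quotring_mul.
Proof.
by move=> x; have [a ->] := to_quotring_surj x; rewrite -to_quotringM mul1r.
Qed.

Lemma quotring_mulDl : left_distributive quotring_mul +%R.
Proof.
move=> x y z; have [[[a ->] [b ->]] [c ->]] :=
  (to_quotring_surj x, to_quotring_surj y, to_quotring_surj z).
by rewrite -raddfD -!to_quotringM -raddfD mulrDl.
Qed.

HB.instance Definition _ := GRing.Zmodule_isComPzRing.Build quotring
  quotring_mulA quotring_mulC quotring_mul1 quotring_mulDl.

Lemma to_quotring_is_monoid_morphism : monoid_morphism to_quotring.
Proof. by split=> // x y; rewrite to_quotringM. Qed.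

HB.instance Definition _ :=
  GRing.isMonoidMorphism.Build R quotring to_quotring
    to_quotring_is_monoid_morphism.

End QuotientRing.

(* The quotient of the module V by the submodule generated by S. *)
Section QuotientModule.
Variables (R : comPzRingType) (V : lmodType R).

Definition is_submod (M : set V) : Prop :=
  M 0 /\ forall a x y, M x -> M y -> M (a *: x + y).

Definition submod_gen (S : set V) : set V := smallest is_submod S.

Lemma submod_gen_is_submod (S : set V) : is_submod (submod_gen S).
Proof.
split=> [M [[M0 _] _] // | a x y Mx My M [smM sSM]].
by apply: smM.2; [apply: Mx | apply: My].
Qed.

Definition submod_gen_pred (S : set V) : V -> bool :=
  fun x => `[< submod_gen S x >].

Lemma submod_gen_zmod_closed (S : set V) : zmod_closed (submod_gen_pred S).
Proof.
have [M0 MP] := submod_gen_is_submod S.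
split=> [|x y /asboolP Mx /asboolP My]; apply/asboolP => //.
by rewrite addrC -scaleN1r; apply: MP.
Qed.

HB.instance Definition _ (S : set V) :=
  GRing.isZmodClosed.Build V (submod_gen_pred S) (submod_gen_zmod_closed S).

Definition submod_gen_zmod (S : set V) : zmodClosed V :=
  GRing.ZmodClosed.clone V (submod_gen_pred S) _.

Variable S : set V.

Definition quotmod := Quotient.quot (submod_gen_zmod S).

HB.instance Definition _ := GRing.Zmodule.on quotmod.

Definition to_quotmod (x : V) : quotmod := \pi_(Quotient.quot (submod_gen_zmod S)) x.

Lemma to_quotmod_eq x y : to_quotmod x = to_quotmod y <-> submod_gen S (x - y).
Proof.
rewrite /to_quotmod; split=> [/eqP | h].
  by rewrite -Quotient.idealrBE => /asboolP.
by apply/eqP; rewrite -Quotient.idealrBE; apply/asboolP.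
Qed.

Definition quotmod_repr (x : quotmod) : V := repr x.

Lemma quotmod_reprK : cancel quotmod_repr to_quotmod.
Proof. by move=> x; rewrite /to_quotmod reprK. Qed.

Lemma to_quotmod_surj (x : quotmod) : exists a, x = to_quotmod a.
Proof. by exists (quotmod_repr x); rewrite quotmod_reprK. Qed.

Lemma to_quotmod_is_zmod_morphism : zmod_morphism to_quotmod.
Proof. by move=> x y; rewrite /to_quotmod raddfB. Qed.

HB.instance Definition _ :=
  GRing.isZmodMorphism.Build V quotmod to_quotmod to_quotmod_is_zmod_morphism.

Definition quotmod_scale (a : R) (x : quotmod) : quotmod :=
  to_quotmod (a *: quotmod_repr x).

Lemma to_quotmodZ a x : to_quotmod (a *: x) = quotmod_scale a (to_quotmod x).
Proof.
have [M0 MP] := submod_gen_is_submod S.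
apply/to_quotmod_eq; rewrite -scalerBr -[_ *: _]addr0; apply: MP => //.
by apply/to_quotmod_eq; rewrite quotmod_reprK.
Qed.

Lemma quotmod_scaleA a b x :
  quotmod_scale a (quotmod_scale b x) = quotmod_scale (a * b) x.
Proof.
by have [v ->] := to_quotmod_surj x; rewrite -!to_quotmodZ scalerA.
Qed.

Lemma quotmod_scale1 : left_id 1 quotmod_scale.
Proof.
by move=> x; have [v ->] := to_quotmod_surj x; rewrite -to_quotmodZ scale1r.
Qed.

Lemma quotmod_scaleDr : right_distributive quotmod_scale +%R.
Proof.
move=> a x y; have [[v ->] [w ->]] := (to_quotmod_surj x, to_quotmod_surj y).
by rewrite -raddfD -!to_quotmodZ -raddfD scalerDr.
Qed.

Lemma quotmod_scaleDl x : {morph quotmod_scale^~ x : a b / a + b}.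
Proof.
move=> a b; have [v ->] := to_quotmod_surj x.
by rewrite -!to_quotmodZ scalerDl raddfD.
Qed.

HB.instance Definition _ := GRing.Zmodule_isLmodule.Build R quotmod
  quotmod_scaleA quotmod_scale1 quotmod_scaleDr quotmod_scaleDl.

Lemma to_quotmod_is_scalable : scalable to_quotmod.
Proof. by move=> a x; rewrite to_quotmodZ. Qed.

HB.instance Definition _ := GRing.isScalable.Build R V quotmod *:%R to_quotmod
  to_quotmod_is_scalable.

End QuotientModule.

(* The free R-module on X; monalg equips {malg R[X]} with a module structure
   only when R is nontrivial. *)
Section FreeModule.
Variables (R : comPzRingType) (X : choiceType).

Definition freemod := {malg R[X]}.

HB.instance Definition _ := GRing.Zmodule.on freemod.

Definition freemod_gen (x : X) : freemod := << 1 *g x >>.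

Definition freemod_scale (a : R) (g : freemod) : freemod :=
  [malg x in msupp g => a * g@_x].

Lemma freemod_scaleE a g x : (freemod_scale a g)@_x = a * g@_x.
Proof. by rewrite mcoeffE; case: msuppP; rewrite ?mulr0. Qed.

Lemma freemod_scaleA a b g :
  freemod_scale a (freemod_scale b g) = freemod_scale (a * b) g.
Proof. by apply/malgP => x; rewrite !freemod_scaleE mulrA. Qed.

Lemma freemod_scale1 : left_id 1 freemod_scale.
Proof. by move=> g; apply/malgP => x; rewrite freemod_scaleE mul1r. Qed.

Lemma freemod_scaleDr : right_distributive freemod_scale +%R.
Proof.
by move=> a g h; apply/malgP => x; rewrite !(freemod_scaleE, mcoeffD) mulrDr.
Qed.

Lemma freemod_scaleDl g : {morph freemod_scale^~ g : a b / a + b}.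
Proof.
by move=> a b; apply/malgP => x; rewrite !(freemod_scaleE, mcoeffD) mulrDl.
Qed.

HB.instance Definition _ := GRing.Zmodule_isLmodule.Build R freemod
  freemod_scaleA freemod_scale1 freemod_scaleDr freemod_scaleDl.

End FreeModule.

(* The localization S^-1 R of R at a multiplicative subset S. *)
Record mulset (R : comPzRingType) := MulSet {
  mulset_car :> R -> Prop;
  mulset1 : mulset_car 1;
  mulsetM : forall x y, mulset_car x -> mulset_car y -> mulset_car (x * y) }.

Section Localization.
Variables (R : comPzRingType) (S : mulset R).

Definition prefrac := {x : R * R | `[< S x.2 >]}.

Definition mkprefrac (a s : R) (Ss : S s) : prefrac :=
  exist (fun x : R * R => `[< S x.2 >]) (a, s) (asboolT Ss).

Lemma prefrac_den (x : prefrac) : S (val x).2.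
Proof. by case: x => /= x /asboolP. Qed.

Definition prefrac_eqv : rel prefrac := fun x y =>
  `[< exists2 t, S t &
        t * ((val x).1 * (val y).2) = t * ((val y).1 * (val x).2) >].

Lemma prefrac_eqv_is_equiv : equiv_class_of prefrac_eqv.
Proof.
split=> [x|x y|y x z].
- by apply/asboolP; exists 1 => //; exact: mulset1.
- by apply/asboolP/asboolP => -[t St e]; exists t.
move=> /asboolP[t St e] /asboolP[t' St' e']; apply/asboolP.
have Sy := prefrac_den y.
exists (t * t' * (val y).2); first by do !apply: mulsetM.
case: (val x) (val y) (val z) e e' {Sy} => [a s] [b u] [c v] /= e e'.
have -> : t * t' * u * (a * v) = t' * v * (t * (a * u)) by ring.
have -> : t * t' * u * (c * s) = t * s * (t' * (c * u)) by ring.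
by rewrite e -e'; ring.
Qed.

Canonical prefrac_eqv_equiv := EquivRelPack prefrac_eqv_is_equiv.
Canonical prefrac_eqv_encModRel := defaultEncModRel prefrac_eqv.

Definition loc := {eq_quot prefrac_eqv}.

HB.instance Definition _ : EqQuotient prefrac prefrac_eqv loc :=
  EqQuotient.on loc.
HB.instance Definition _ := Choice.on loc.


Definition frac (a s : R) (Ss : S s) : loc := \pi_loc (mkprefrac a Ss).

Lemma frac_eq a s (Ss : S s) b u (Su : S u) :
  frac a Ss = frac b Su <-> exists2 t, S t & t * (a * u) = t * (b * s).
Proof.
rewrite /frac; split=> [/eqP | h].
  by rewrite eqmodE => /asboolP.
by apply/eqP; rewrite eqmodE; apply/asboolP.
Qed.

Definition num (x : loc) : R := (val (repr x)).1.
Definition den (x : loc) : R := (val (repr x)).2.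

Lemma denP x : S (den x). Proof. exact: prefrac_den. Qed.

Lemma frac_num_den x : frac (num x) (denP x) = x.
Proof.
rewrite /frac -[RHS]reprK; congr (\pi_loc _).
by apply/val_inj => /=; rewrite -surjective_pairing.
Qed.

Lemma fracP (x : loc) : exists a s (Ss : S s), x = frac a Ss.
Proof. by exists (num x), (den x), (denP x); rewrite frac_num_den. Qed.

Definition loc_zero : loc := frac 0 (mulset1 S).
Definition loc_one : loc := frac 1 (mulset1 S).
Definition loc_opp (x : loc) : loc := frac (- num x) (denP x).
Definition loc_add (x y : loc) : loc :=
  frac (num x * den y + num y * den x) (mulsetM (denP x) (denP y)).
Definition loc_mul (x y : loc) : loc :=
  frac (num x * num y) (mulsetM (denP x) (denP y)).

Lemma frac_numden a s (Ss : S s) (x := frac a Ss) :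
  exists2 t, S t & t * (num x * s) = t * (a * den x).
Proof. by apply/(frac_eq (num x) (denP x) a Ss); rewrite frac_num_den. Qed.

Lemma loc_oppE a s (Ss : S s) : loc_opp (frac a Ss) = frac (- a) Ss.
Proof.
apply/frac_eq; have [t St e] := frac_numden a Ss; exists t => //.
by rewrite !mulNr !mulrN e.
Qed.

Lemma loc_addE a s (Ss : S s) b u (Su : S u) :
  loc_add (frac a Ss) (frac b Su) = frac (a * u + b * s) (mulsetM Ss Su).
Proof.
apply/frac_eq; have [t St e] := frac_numden a Ss.
have [t' St' e'] := frac_numden b Su; exists (t * t'); first exact: mulsetM.
move: (num (frac a Ss)) (den (frac a Ss)) e => p q e.
move: (num (frac b Su)) (den (frac b Su)) e' => p' q' e'.
have -> : t * t' * ((p * q' + p' * q) * (s * u)) =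
  t' * u * q' * (t * (p * s)) + t * q * s * (t' * (p' * u)) by ring.
by rewrite e e'; ring.
Qed.

Lemma loc_mulE a s (Ss : S s) b u (Su : S u) :
  loc_mul (frac a Ss) (frac b Su) = frac (a * b) (mulsetM Ss Su).
Proof.
apply/frac_eq; have [t St e] := frac_numden a Ss.
have [t' St' e'] := frac_numden b Su; exists (t * t'); first exact: mulsetM.
move: (num (frac a Ss)) (den (frac a Ss)) e => p q e.
move: (num (frac b Su)) (den (frac b Su)) e' => p' q' e'.
have -> : t * t' * (p * p' * (s * u)) =
  (t * (p * s)) * (t' * (p' * u)) by ring.
by rewrite e e'; ring.
Qed.

Lemma eq_frac a s (Ss : S s) b u (Su : S u) :
  a * u = b * s -> frac a Ss = frac b Su.
Proof. by move=> e; apply/frac_eq; exists 1; [exact: mulset1 | rewrite e]. Qed.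

Lemma loc_addA : associative loc_add.
Proof.
move=> x y z; have [[[a [s [Ss ->]]] [b [u [Su ->]]]] [c [v [Sv ->]]]] :=
  (fracP x, fracP y, fracP z).
by rewrite !loc_addE; apply: eq_frac; ring.
Qed.

Lemma loc_addC : commutative loc_add.
Proof.
move=> x y; have [[a [s [Ss ->]]] [b [u [Su ->]]]] := (fracP x, fracP y).
by rewrite !loc_addE; apply: eq_frac; ring.
Qed.

Lemma loc_add0 : left_id loc_zero loc_add.
Proof.
by move=> x; have [a [s [Ss ->]]] := fracP x; rewrite loc_addE;
  apply: eq_frac; ring.
Qed.

Lemma loc_addN : left_inverse loc_zero loc_opp loc_add.
Proof.
by move=> x; have [a [s [Ss ->]]] := fracP x; rewrite loc_oppE loc_addE;
  apply: eq_frac; ring.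
Qed.

HB.instance Definition _ := GRing.isZmodule.Build loc
  loc_addA loc_addC loc_add0 loc_addN.

Lemma loc_mulA : associative loc_mul.
Proof.
move=> x y z; have [[[a [s [Ss ->]]] [b [u [Su ->]]]] [c [v [Sv ->]]]] :=
  (fracP x, fracP y, fracP z).
by rewrite !loc_mulE; apply: eq_frac; ring.
Qed.

Lemma loc_mulC : commutative loc_mul.
Proof.
move=> x y; have [[a [s [Ss ->]]] [b [u [Su ->]]]] := (fracP x, fracP y).
by rewrite !loc_mulE; apply: eq_frac; ring.
Qed.

Lemma loc_mul1 : left_id loc_one loc_mul.
Proof.
by move=> x; have [a [s [Ss ->]]] := fracP x; rewrite loc_mulE;
  apply: eq_frac; ring.
Qed.

Lemma loc_mulDl : left_distributive loc_mul loc_add.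
Proof.
move=> x y z; have [[[a [s [Ss ->]]] [b [u [Su ->]]]] [c [v [Sv ->]]]] :=
  (fracP x, fracP y, fracP z).
by rewrite !(loc_mulE, loc_addE); apply: eq_frac; ring.
Qed.

HB.instance Definition _ := GRing.Zmodule_isComPzRing.Build loc
  loc_mulA loc_mulC loc_mul1 loc_mulDl.

Definition to_loc (a : R) : loc := frac a (mulset1 S).

Lemma to_loc_is_zmod_morphism : zmod_morphism to_loc.
Proof.
move=> a b; rewrite -[RHS]/(loc_add (to_loc a) (loc_opp (to_loc b))).
by rewrite /to_loc loc_oppE loc_addE; apply: eq_frac; ring.
Qed.

Lemma to_loc_is_monoid_morphism : monoid_morphism to_loc.
Proof.
split=> // a b; rewrite -[RHS]/(loc_mul (to_loc a) (to_loc b)).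
by rewrite /to_loc loc_mulE; apply: eq_frac; ring.
Qed.

HB.instance Definition _ :=
  GRing.isZmodMorphism.Build R loc to_loc to_loc_is_zmod_morphism.
HB.instance Definition _ :=
  GRing.isMonoidMorphism.Build R loc to_loc to_loc_is_monoid_morphism.

End Localization.

Definition reduced (R : comPzRingType) : Prop :=
  forall (x : R) (k : nat), x ^+ k = 0 -> x = 0.

(* The total ring of fractions; it is the fraction field when R is an integral
   domain. *)
Section TotalFractions.
Variable R : comPzRingType.

Definition nonzerodiv (s : R) : Prop := forall x, s * x = 0 -> x = 0.

Lemma nonzerodiv1 : nonzerodiv 1.
Proof. by move=> x; rewrite mul1r. Qed.

Lemma nonzerodivM x y : nonzerodiv x -> nonzerodiv y -> nonzerodiv (x * y).
Proof. by move=> rx ry z; rewrite -mulrA => /rx/ry. Qed.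

Definition nonzerodivs : mulset R := MulSet nonzerodiv1 nonzerodivM.

Definition total_frac := loc nonzerodivs.

HB.instance Definition _ := GRing.ComPzRing.on total_frac.

End TotalFractions.

Section Spec.
Variable A : comPzRingType.

Record spec := Spec { spec_car :> A -> Prop; spec_prime : is_prime spec_car }.

HB.instance Definition _ := gen_eqMixin spec.
HB.instance Definition _ := gen_choiceMixin spec.

Lemma specP (P Q : spec) : (forall x, P x <-> Q x) -> P = Q.
Proof.
case: P Q => P hP [Q hQ] /= e.
have PQ : P = Q by apply/funext => x; apply/propext.
by case: _ / PQ hQ => hQ; congr Spec; exact: Prop_irrelevance.
Qed.

Definition vanishing (S : set A) : set spec :=
  [set P : spec | forall x, S x -> P x].

Definition zariski_open (U : set spec) : Prop :=
  exists S : set A, U = ~` vanishing S.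

Lemma zariski_openT : zariski_open setT.
Proof.
exists [set 1]; apply/seteqP; split=> // P _ /(_ 1 erefl).
by have [_ P1 _] := spec_prime P.
Qed.

Lemma zariski_openI : setI_closed zariski_open.
Proof.
move=> _ _ [S ->] [T ->].
exists [set x | exists a b, [/\ S a, T b & x = a * b]].
apply/seteqP; split=> P /=; have [[P0 IP] _ Pp] := spec_prime P.
  move=> [nS nT] PST.
  have [a [Sa nPa]] : exists a, S a /\ ~ P a.
    by apply: contrapT => h; apply: nS => x Sx; apply: contrapT => nPx;
      apply: h; exists x.
  apply: nT => b Tb.
  by have [//|//] := Pp a b (PST _ (ex_intro _ a (ex_intro _ b (And3 Sa Tb erefl)))).
move=> nPST; split=> PS; apply: nPST => _ [a [b [Sa Tb ->]]].
  by rewrite mulrC -[_ * _]addr0; apply: IP => //; apply: PS.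
by rewrite -[_ * _]addr0; apply: IP => //; apply: PS.
Qed.

Lemma zariski_open_bigU (I : Type) (f : I -> set spec) :
  (forall i, zariski_open (f i)) -> zariski_open (\bigcup_i f i).
Proof.
move=> /choice[S fS]; exists (\bigcup_i S i); apply/seteqP; split=> P.
  by move=> [i _]; rewrite fS => nPS PS; apply: nPS => x Sx; apply: PS; exists i.
move=> nPS; apply: contrapT => h; apply: nPS => x [i _ Sx].
apply: contrapT => nPx; apply: h; exists i => //; rewrite fS => PS.
by apply: nPx; apply: PS.
Qed.

HB.instance Definition _ := isOpenTopological.Build spec
  zariski_openT zariski_openI zariski_open_bigU.

Lemma zariski_closedP (Z : set spec) :
  closed Z <-> exists S : set A, Z = vanishing S.
Proof.
split=> [/closed_openC [S e] | [S ->]].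
  by exists S; rewrite -[Z]setCK e setCK.
by rewrite -[vanishing S]setCK; apply: open_closedC; exists S.
Qed.

End Spec.

Definition irreducible (T : topologicalType) (Z : set T) : Prop :=
  Z !=set0 /\ forall F G : set T, closed F -> closed G ->
    Z `<=` F `|` G -> Z `<=` F \/ Z `<=` G.

Definition irreducible_component (T : topologicalType) (Z : set T) : Prop :=
  irreducible Z /\ forall Y : set T, irreducible Y -> Z `<=` Y -> Y `<=` Z.

Definition generic_point (T : topologicalType) (Z : set T) (eta : T) : Prop :=
  closure [set eta] = Z.

Section LocalRing.
Variables (A : comPzRingType) (P : spec A).

Definition prime_compl (s : A) : Prop := ~ P s.

Lemma prime_compl1 : prime_compl 1.
Proof. by have [_ P1 _] := spec_prime P. Qed.

Lemma prime_complM x y : prime_compl x -> prime_compl y -> prime_compl (x * y).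
Proof. by have [_ _ Pp] := spec_prime P => nx ny /Pp[]. Qed.

Definition local_ring : comPzRingType := loc (MulSet prime_compl1 prime_complM).

End LocalRing.

(* The domain A / P and its fraction field kappa(P). *)
Section ResidueField.
Variables (A : comPzRingType) (P : spec A).

Definition resdom := quotring P.

HB.instance Definition _ := GRing.ComPzRing.on resdom.

Definition to_resdom : A -> resdom := @to_quotring A P.

HB.instance Definition _ := GRing.RMorphism.on to_resdom.

Lemma to_resdom_eq0 x : to_resdom x = 0 <-> P x.
Proof.
have [idP _ _] := spec_prime P.
rewrite -(rmorph0 to_resdom); split=> [/to_quotring_eq | Px].
  by rewrite subr0 ideal_gen_id.
by apply/to_quotring_eq; rewrite subr0 ideal_gen_id.
Qed.

Lemma to_resdom_surj (x : resdom) : exists a, x = to_resdom a.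
Proof. exact: to_quotring_surj. Qed.

Fact resdom_neq0 : (1 : resdom) != 0.
Proof.
apply/eqP; rewrite -(rmorph1 to_resdom) => /to_resdom_eq0.
by have [_ P1 _] := spec_prime P.
Qed.

HB.instance Definition _ := GRing.PzSemiRing_isNonZero.Build resdom resdom_neq0.

Definition resdom_unit : pred resdom := fun x => `[< exists y, y * x = 1 >].

Definition resdom_inv (x : resdom) : resdom :=
  if pselect (exists y, y * x = 1) is left h then sval (cid h) else x.

Fact resdom_mulVr : {in resdom_unit, left_inverse 1 resdom_inv *%R}.
Proof.
move=> x /asboolP ux; rewrite /resdom_inv.
by case: pselect => // h; exact: (svalP (cid h)).
Qed.

Fact resdom_unitP x y : y * x = 1 -> resdom_unit x.
Proof. by move=> e; apply/asboolP; exists y. Qed.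

Fact resdom_invr_out : {in [predC resdom_unit], resdom_inv =1 id}.
Proof.
by move=> x /asboolPn ux; rewrite /resdom_inv; case: pselect.
Qed.

HB.instance Definition _ := GRing.ComNzRing_hasMulInverse.Build resdom
  resdom_mulVr resdom_unitP resdom_invr_out.

Fact resdom_integral (x y : resdom) : x * y = 0 -> (x == 0) || (y == 0).
Proof.
have [[a ->] [b ->]] := (to_resdom_surj x, to_resdom_surj y).
have [_ _ Pp] := spec_prime P.
rewrite -rmorphM => /to_resdom_eq0/Pp[] /to_resdom_eq0 ->; rewrite eqxx //.
by rewrite orbT.
Qed.

HB.instance Definition _ :=
  GRing.ComUnitRing_isIntegral.Build resdom resdom_integral.

Definition residue_field : fieldType := {fraction resdom}.

Definition to_residue : {rmorphism A -> residue_field} :=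
  @tofrac resdom \o to_resdom.

End ResidueField.

(* Kaehler differentials Omega_(A/k): generators d a for a in A, subject to
   additivity, the Leibniz rule, and d c = 0 for c in the image of k. *)
Section Kaehler.
Variables (k A : comPzRingType) (f : {rmorphism k -> A}).

Local Notation d := (@freemod_gen A A).

Definition kaehler_rel : set (freemod A A) :=
  [set d (p.1 + p.2) - d p.1 - d p.2 | p in [set: A * A]] `|`
  [set d (p.1 * p.2) - p.1 *: d p.2 - p.2 *: d p.1 | p in [set: A * A]] `|`
  [set d (f c) | c in [set: k]].

Definition kaehler : lmodType A := quotmod kaehler_rel.

Definition kaehler_d (a : A) : kaehler := to_quotmod kaehler_rel (d a).

End Kaehler.

(* The base change of an A-module M along f : A -> B, by generators 1 (x) m. *)
Section BaseChange.
Variables (A B : comPzRingType) (f : {rmorphism A -> B}) (M : lmodType A).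

Local Notation g := (@freemod_gen B M).

Definition base_change_rel : set (freemod B M) :=
  [set g (p.1 + p.2) - g p.1 - g p.2 | p in [set: M * M]] `|`
  [set g (p.1 *: p.2) - f p.1 *: g p.2 | p in [set: A * M]].

Definition base_change : lmodType B := quotmod base_change_rel.

Definition to_base_change (m : M) : base_change :=
  to_quotmod base_change_rel (g m).

End BaseChange.

Definition mvar (R : comNzRingType) (I : choiceType) (i : I) :
  {malg R[{cmonom I}]} := << ucm i >>.

Section Constants.
Variables (R : comNzRingType) (I : choiceType).

Definition mconst (c : R) : {malg R[{cmonom I}]} := c%:MP.

Fact mconst_is_zmod_morphism : zmod_morphism mconst.
Proof. by move=> a b; rewrite /mconst raddfB. Qed.

Fact mconst_is_monoid_morphism : monoid_morphism mconst.
Proof. by split=> // a b; rewrite /mconst mpolyCM. Qed.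

HB.instance Definition _ := GRing.isZmodMorphism.Build
  R {malg R[{cmonom I}]} mconst mconst_is_zmod_morphism.
HB.instance Definition _ := GRing.isMonoidMorphism.Build
  R {malg R[{cmonom I}]} mconst mconst_is_monoid_morphism.

End Constants.

(* The symmetric algebra Sym_R(M): the polynomial ring with one variable for
   each element of M, modulo the relations making M -> Sym_R(M) linear. *)
Section SymmetricAlgebra.
Variables (R : comNzRingType) (M : lmodType R).

Local Notation X := (@mvar R M).

Definition sym_rel : set {malg R[{cmonom M}]} :=
  [set X (p.1 + p.2) - X p.1 - X p.2 | p in [set: M * M]] `|`
  [set X (p.1 *: p.2) - mconst M p.1 * X p.2 | p in [set: R * M]].

Definition sym : comPzRingType := quotring sym_rel.

Definition to_sym (m : M) : sym := to_quotring sym_rel (X m).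

Definition sym_const : {rmorphism R -> sym} :=
  @to_quotring _ sym_rel \o @mconst R M.

End SymmetricAlgebra.

(* Suprema in the extended natural numbers, None standing for infinity. *)
Definition enat := option nat.

Definition infty : enat := None.

Definition enat_lt (a b : enat) : Prop :=
  match a, b with
  | Some m, Some n => (m < n)%N
  | Some _, None => True
  | None, _ => False
  end.

Definition enat_sup (E : set nat) : enat :=
  if pselect (exists N, forall m, E m -> (m <= N)%N) is left h
  then Some (\max_(m < (sval (cid h)).+1 | `[< E m >]) m)%N
  else infty.

Section TranscendenceDegree.
Variables (F : fieldType) (L : comPzRingType) (f : {rmorphism F -> L}).

Definition poly_eval (I : choiceType) (t : I -> L) (p : {malg F[{cmonom I}]}) : L :=
  \sum_(m <- msupp p) f p@_m * \prod_(i <- finsupp m) t i ^+ m i.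

Definition alg_independent (I : choiceType) (t : I -> L) : Prop :=
  forall p : {malg F[{cmonom I}]}, poly_eval t p = 0 -> p = 0.

Definition trdeg : enat :=
  enat_sup [set m : nat | exists t : 'I_m -> L, alg_independent t].

End TranscendenceDegree.

(* K{x_1, ..., x_n}; the variable indexed by (i, r) is x_i^(r). *)
Notation diffpoly K n := {malg K[{cmonom ('I_n * nat)%type}]}.

Definition is_derivation (R : comPzRingType) (D : R -> R) : Prop :=
  (forall x y, D (x + y) = D x + D y) /\
  (forall x y, D (x * y) = D x * y + x * D y).

Fact leibniz_sum (R : comPzRingType) (D : R -> R) (I J : Type)
    (r : seq I) (s : seq J) (F : I -> R) (G : J -> R) :
    (forall x y, D (x + y) = D x + D y) ->
    (forall i j, D (F i * G j) = D (F i) * G j + F i * D (G j)) ->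
  let x := \sum_(i <- r) F i in let y := \sum_(j <- s) G j in
  D (x * y) = D x * y + x * D y.
Proof.
move=> DD DM /=; have D0 : D 0 = 0.
  by apply: (addrI (D 0)); rewrite -DD !addr0.
have DS K (t : seq K) (H : K -> R) : D (\sum_(i <- t) H i) = \sum_(i <- t) D (H i).
  exact: (big_morph D DD D0).
rewrite !DS !big_distrlr /= DS -big_split /=.
by apply: eq_bigr => i _; rewrite DS -big_split /=; apply: eq_bigr.
Qed.

Section DifferentialPolynomials.
Variables (K : fieldType) (delta : K -> K) (n : nat).

Local Notation V := ('I_n * nat)%type.

Definition dvar (v : V) : V := (v.1, v.2.+1).

(* The Leibniz rule on c * m, with d(x_v ^ e) = e x_v ^ (e - 1) x_(dvar v); see
   dpoly_const, dpoly_var and dpoly_is_derivation. *)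
Definition dmonom (c : K) (m : {cmonom V}) : diffpoly K n :=
  << delta c *g m >> +
  \sum_(v <- finsupp m)
    << c *+ m v *g mulcm (divcm m (ucm v)) (ucm (dvar v)) >>.

Definition dpoly (p : diffpoly K n) : diffpoly K n :=
  \sum_(m <- msupp p) dmonom p@_m m.

Hypothesis deltaP : is_derivation delta.

Let deltaD := deltaP.1.
Let deltaM := deltaP.2.

Let delta0 : delta 0 = 0.
Proof. by apply: (addrI (delta 0)); rewrite -deltaD !addr0. Qed.

Let delta1 : delta 1 = 0.
Proof.
by apply: (addrI (delta 1)); rewrite addr0 -[in RHS](mulr1 1) deltaM mulr1 mul1r.
Qed.

Let dmonom0 m : dmonom 0 m = 0.
Proof.
rewrite /dmonom delta0 monalgU0 add0r big1 // => v _.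
by rewrite mul0rn monalgU0.
Qed.

Let dmonomD m : {morph dmonom^~ m : c c' / c + c'}.
Proof.
move=> c c'; rewrite /dmonom deltaD monalgUD addrACA -big_split /=.
by congr (_ + _); apply: eq_bigr => v _; rewrite mulrnDl monalgUD.
Qed.

Let dpolyEw (d : {fset {cmonom V}}) p :
  (msupp p `<=` d)%fset -> dpoly p = \sum_(m <- d) dmonom p@_m m.
Proof.
move=> le; rewrite /dpoly (big_fset_incl _ le) //= => m _ /mcoeff_outdom ->.
exact: dmonom0.
Qed.

Lemma dpolyD p q : dpoly (p + q) = dpoly p + dpoly q.
Proof.
rewrite (dpolyEw (msuppD_le p q)) (dpolyEw (fsubsetUl (msupp p) (msupp q))).
rewrite (dpolyEw (fsubsetUr (msupp p) (msupp q))) -big_split /=.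
by apply: eq_bigr => m _; rewrite mcoeffD dmonomD.
Qed.

Let dpolyU c m : dpoly << c *g m >> = dmonom c m.
Proof. by rewrite (dpolyEw (@msuppU_le _ _ _ _)) big_seq_fset1 mcoeffUU. Qed.

Lemma dpoly_const c : dpoly (mconst V c) = mconst V (delta c).
Proof. by rewrite dpolyU /dmonom mdom1 big_seq_fset0 addr0. Qed.

Lemma dpoly_var v : dpoly (mvar K v) = mvar K (dvar v).
Proof.
rewrite dpolyU /dmonom delta1 monalgU0 add0r mdomU big_seq_fset1 ucmE eqxx mulr1n.
rewrite /mvar; congr (mkmalgU _ 1); apply/eqP/cmP => i.
by rewrite mulcmE divcmE subnn.
Qed.

Let dmonomM c m c' m' :
  dmonom (c * c') (mulcm m m') =
  dmonom c m * << c' *g m' >> + << c *g m >> * dmonom c' m'.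
Proof.
have UU a b (k l : {cmonom V}) :
    << a *g k >> * << b *g l >> = << a * b *g mulcm k l >> :> diffpoly K n.
  exact: fgmulUU.
have E (R : comPzRingType) (x y z a b d : R) :
    (x + y) * z + a * (b + d) = (x * z + a * b) + (y * z + a * d) by ring.
rewrite /dmonom [RHS]E !{1}UU deltaM monalgUD; congr (_ + _).
rewrite [X in _ = X + _]mulr_suml [X in _ = _ + X]mulr_sumr mdomD.
have wid (m0 : {cmonom V}) (F : V -> diffpoly K n) :
    (finsupp m0 `<=` finsupp m `|` finsupp m')%fset ->
    (forall v, m0 v = 0%N -> F v = 0) ->
    \sum_(v <- finsupp m0) F v =
    \sum_(v <- (finsupp m `|` finsupp m')%fset) F v.
  move=> le F0; apply: big_fset_incl le _ => v _ /=.
  by rewrite -cmE_eq0 => /eqP /F0.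
rewrite (wid m) ?fsubsetUl => [|//|v mv]; last by rewrite mv mulr0n monalgU0; apply: mul0r.
rewrite (wid m') ?fsubsetUr => [|//|v mv]; last by rewrite mv mulr0n monalgU0; apply: mulr0.
rewrite -big_split /=; apply: eq_bigr => v _.
rewrite [X in _ = X + _]UU [X in _ = _ + X]UU.
have -> : c *+ m v * c' = c * c' *+ m v by rewrite mulrnAl.
have -> : c * (c' *+ m' v) = c * c' *+ m' v by rewrite mulrnAr.
rewrite (mulcmE m m' v) (mulrnDr (c * c')) [LHS]monalgUD.
apply: (f_equal2 (fun x y => x + y)).
  have [-> | mv] := posnP (m v); first by rewrite mulr0n !monalgU0.
  apply: (f_equal (mkmalgU^~ _)); apply/eqP/cmP => i; rewrite !(mulcmE, divcmE, ucmE).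
  by case: eqP => [<-|_]; lia.
have [-> | mv] := posnP (m' v); first by rewrite mulr0n !monalgU0.
apply: (f_equal (mkmalgU^~ _)); apply/eqP/cmP => i; rewrite !(mulcmE, divcmE, ucmE).
by case: eqP => [<-|_]; lia.
Qed.

Lemma dpolyM p q : dpoly (p * q) = dpoly p * q + p * dpoly q.
Proof.
rewrite (monalgE p) (monalgE q); apply: leibniz_sum dpolyD _ => m m'.
apply: etrans (f_equal dpoly (fgmulUU _ _ _ _)) _.
apply: etrans (dpolyU _ _) _; apply: etrans (dmonomM _ _ _ _) _.
exact: (f_equal2 (fun x y => x * _ + _ * y) (esym (dpolyU _ _))
                 (esym (dpolyU _ _))).
Qed.

Theorem dpoly_is_derivation : is_derivation dpoly.
Proof. by split; [exact: dpolyD | exact: dpolyM]. Qed.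

End DifferentialPolynomials.

Arguments dpoly {K} delta {n} p.

Section DifferentialScheme.
Variables (K : fieldType) (delta : K -> K) (n : nat) (u : 'I_n -> diffpoly K n).

Definition diffideal_gens : set (diffpoly K n) :=
  [set iter p.2 (dpoly delta) (u p.1) | p in [set: 'I_n * nat]].

Definition diffquot : comPzRingType := quotring diffideal_gens.

Definition diffquot_const : {rmorphism K -> diffquot} :=
  @to_quotring _ diffideal_gens \o @mconst K ('I_n * nat)%type.

End DifferentialScheme.

Section ComponentDimensions.
Variables (K : fieldType) (A : comPzRingType) (f : {rmorphism K -> A}).

(* The dimension of the integral subscheme of Spec A with generic point eta. *)
Definition dim_at (eta : spec A) : enat := trdeg (to_residue eta \o f).

(* The coordinate ring of the fiber over eta of the tangent bundle of Spec A,
   an algebra over the residue field of eta. *)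
Definition tangent_fiber (eta : spec A) : comPzRingType :=
  sym (base_change (to_residue eta) (kaehler f)).

Definition tangent_fiber_const (eta : spec A) :
    {rmorphism residue_field eta -> tangent_fiber eta} :=
  sym_const (base_change (to_residue eta) (kaehler f)).

(* The fiber is integral, being the spectrum of the symmetric algebra of a
   vector space, so its total ring of fractions is its function field. *)
Definition dim_tangent_fiber (eta : spec A) : enat :=
  trdeg (@to_loc _ (nonzerodivs (tangent_fiber eta)) \o tangent_fiber_const eta).

End ComponentDimensions.

Definition generically_reduced (A : comPzRingType) (Z : set (spec A)) : Prop :=
  forall eta, generic_point Z eta -> reduced (local_ring eta).

(* Main.v *)
From HB Require Import structures.
Require Import Defs.
From mathcomp Require Import all_boot all_algebra finmap ring zify.
From mathcomp.multinomials Require Import monalg.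
From mathcomp Require Import boolp classical_sets topology.

Set Implicit Arguments.
Unset Strict Implicit.
Unset Printing Implicit Defensive.

Import GRing.Theory.
Local Open Scope ring_scope.

(** The argument concerns an algebra [A] over a field [K] of characteristic zero
    and a minimal prime [P] of [A].  Suppose that the local ring of [A] at [P] is
    reduced, let [k] be the residue field of [P] and let [d] be
    its transcendence degree over [K], assumed finite.  Then the tangent fiber
    over [P] has dimension at most [d], which contradicts the strict inequality
    of the hypothesis.

    Since [P] is minimal, its elements are nilpotent in the local ring
    ([minimal_prime_nilpotent]), hence zero there: each [p] in [P] is killed by
    some [s] outside [P].  Applying the Leibniz rule to [s * p = 0] shows that
    the derivation [D a = da (x) 1] of [A] into the cotangent space
    [V], the base change of the differentials of [A] to [k], vanishes on [P].
    So if the images in [k] of some elements [a_i] of [A] satisfy a polynomial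
    relation [p] over [K], then applying [D] to [p(a) = 0] gives a linear
    relation between the [D a_i], with the partial derivatives of [p] as
    coefficients.  In characteristic zero, taking [p] of minimal degree makes
    this relation nontrivial ([alg_independent_of_derivation]).
    Contrapositively, linearly independent [D a_i] come from algebraically
    independent [a_i], so there are at most [d] of them; a maximal such family
    spans [V], which is therefore spanned by at most [d] vectors.

    Consequently the symmetric algebra of [V] is generated over [k] by at most
    [d] elements.  Counting monomials shows that more than [d] elements of a
    localization of such an algebra are algebraically dependent
    ([alg_independent_loc]): the dimension of a space of polynomials of bounded
    degree in [d] variables grows like the [d]-th power of the bound. *)

(** * Minimal primes *)

(** A smaller prime [Q] would have an irreducible closure containing [Z], hence
    equal to [Z]; then [Q] lies in the closure of [P], that is, contains [P]. *)
Lemma minimal_prime_of_component (A : comPzRingType) (Z : set (spec A))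
    (P : spec A) :
  irreducible_component Z -> generic_point Z P ->
  forall Q : spec A, (forall x, Q x -> P x) -> forall x, P x -> Q x.
Proof.
move=> + eZ; rewrite -{Z}eZ => -[_ maxZ] Q QP x Px.
have sub : (closure [set P] `<=` closure [set Q])%classic.
  have [S eS] := (zariski_closedP _).1 (@closed_closure _ [set Q]).
  rewrite [X in (_ `<=` X)%classic]eS closureE.
  apply: smallest_sub; first by apply/zariski_closedP; exists S.
  move=> _ -> y Sy; apply: QP.
  have : closure [set Q] Q by apply: subset_closure.
  by rewrite eS; apply.
have irrQ : irreducible (closure [set Q]).
  split; first by exists Q; apply: subset_closure.
  move=> F G cF cG QFG.
  have /QFG[FQ|GQ] : closure [set Q] Q by apply: subset_closure.
    by left; rewrite closureE; apply: smallest_sub => // _ ->.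
  by right; rewrite closureE; apply: smallest_sub => // _ ->.
have : closure [set P] Q by apply: (maxZ _ irrQ sub); apply: subset_closure.
suff cl : (closure [set P] `<=` vanishing (P : A -> Prop))%classic.
  by move=> /cl; apply.
rewrite closureE; apply: smallest_sub => [|_ -> //].
by apply/zariski_closedP; exists (P : A -> Prop).
Qed.

(** An ideal maximal among those disjoint from [T] is prime: enlarging it by [x]
    or by [y] makes it meet [T], so if it contained [x * y] it would contain the
    product of two elements of [T]. *)
Lemma prime_avoiding (A : comPzRingType) (T : mulset A) :
  ~ T 0 -> exists Q : spec A, forall x, Q x -> ~ T x.
Proof.
move=> T0.
(* Zorn's lemma also asks about the empty chain, whose union is empty, so the
   ideals are not yet required to contain 0. *)
pose good (I : set A) :=
  (forall a x y, I x -> I y -> I (a * x + y)) /\ forall x, I x -> ~ T x.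
have /Zorn_bigcup[I [[IP IT] maxI]] : forall F : set (set A),
    (F `<=` good)%classic -> total_on F subset ->
    good (\bigcup_(X in F) X)%classic.
  move=> F Fgood Ftot; split=> [a x y [X FX Xx] [Y FY Yy]|x [X FX Xx]]; last first.
    by have [_] := Fgood _ FX; apply.
  have [XY|YX] := Ftot _ _ FX FY.
    by exists Y => //; have [YP _] := Fgood _ FY; apply: YP => //; apply: XY.
  by exists X => //; have [XP _] := Fgood _ FX; apply: XP => //; apply: YX.
have I0 : I 0.
  apply: contrapT => nI0; apply: (maxI [set 0 | _ in [set: A]]%classic).
    split=> [x Ix|sub].
      by case: nI0; rewrite -(addNr x) -mulN1r; apply: IP.
    by apply: nI0; apply: sub; exists 0.
  split=> [a x y [_ _ <-] [_ _ <-]|x [_ _ <-] //].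
  by exists 0; rewrite ?mulr0 ?addr0.
have ext x : ~ I x -> exists a y, I y /\ T (a * x + y).
  move=> nIx; apply: contrapT => noT.
  apply: (maxI [set z | exists a y, I y /\ z = a * x + y]%classic).
    split=> [y Iy|sub]; first by exists 0, y; rewrite mul0r add0r.
    by apply/nIx/sub; exists 1, 0; rewrite mul1r addr0.
  split=> [c _ _ [a [y [Iy ->]]] [b [z [Iz ->]]]|z [a [y [Iy ->]]] Tz].
    by exists (c * a + b), (c * y + z); split; [apply: IP | ring].
  by apply: noT; exists a, y.
have prI : is_prime I.
  split=> [||x y Ixy]; first by split.
    by move=> /IT; apply; apply: mulset1.
  apply: contrapT => /not_orP[/ext[a [z [Iz Ta]]] /ext[b [w [Iw Tb]]]].
  apply: (IT _ _ (mulsetM Ta Tb)).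
  rewrite (_ : _ * _ = (a * b) * (x * y) + (a * x * w + (b * y + w) * z)).
    by apply: (IP) => //; rewrite -[_ * z]addr0; do 2!apply: (IP) => //.
  by ring.
by exists (Spec prI).
Qed.

(** Otherwise 0 is not of the form [s * p ^+ k] with [s] outside [P], and a
    prime avoiding all these products would be strictly smaller than [P]. *)
Lemma minimal_prime_nilpotent (A : comPzRingType) (P : spec A) :
  (forall Q : spec A, (forall x, Q x -> P x) -> forall x, P x -> Q x) ->
  forall p, P p -> exists s k, ~ P s /\ s * p ^+ k = 0.
Proof.
move=> minP p Pp; apply: contrapT => noS.
have [_ nP1 Pprime] := spec_prime P.
pose S x := exists s k, ~ P s /\ x = s * p ^+ k.
have S1 : S 1 by exists 1, 0%N; rewrite mul1r.
have SM x y : S x -> S y -> S (x * y).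
  move=> [s [k [Ps ->]]] [t [l [Pt ->]]].
  exists (s * t), (k + l)%N; split; first by move=> /Pprime[].
  by rewrite exprD; ring.
have [|Q QS] := @prime_avoiding _ (MulSet S1 SM).
  by move=> [s [k [Ps e]]]; apply: noS; exists s, k.
have /QS[] : Q p.
  apply: minP => // x Qx; apply: contrapT => nPx; apply: (QS x Qx).
  by exists x, 0%N; rewrite mulr1.
by exists 1, 1%N; rewrite mul1r.
Qed.

(** The image of [p] in the local ring is nilpotent, hence zero; this is what
    generic reducedness means for the elements of [A]. *)
Lemma reduced_minimal_prime (A : comPzRingType) (P : spec A) :
  (forall Q : spec A, (forall x, Q x -> P x) -> forall x, P x -> Q x) ->
  reduced (local_ring P) ->
  forall p, P p -> exists2 s, ~ P s & s * p = 0.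
Proof.
move=> minP redP p /(minimal_prime_nilpotent minP)[s [k [Ps e]]].
set S := MulSet (@prime_compl1 _ P) (@prime_complM _ P).
have /(redP (to_loc S p) k) : to_loc S p ^+ k = 0.
  rewrite -rmorphXn -(rmorph0 (to_loc S)); apply/frac_eq.
  by exists s => //; rewrite mulr1 e mul0r mulr0.
rewrite -(rmorph0 (to_loc S)) => /frac_eq[t Pt].
by rewrite mulr1 mul0r mulr0 => tp; exists t.
Qed.

(** * Dimensions as suprema *)

Lemma enat_lt_sup (d : nat) (E : set nat) :
  enat_lt (Some d) (enat_sup E) -> exists2 m, E m & (d < m)%N.
Proof.
rewrite /enat_sup; case: pselect => [h|h] dE; last first.
  apply: contrapT => noE; apply: h; exists d => m Em.
  by rewrite leqNgt; apply/negP => dm; apply: noE; exists m.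
apply: contrapT => noE; move: dE => /=; apply/negP; rewrite -leqNgt.
apply/bigmax_leqP => m /asboolP Em; rewrite leqNgt; apply/negP => dm.
by apply: noE; exists m.
Qed.

Lemma enat_sup_some (d : nat) (E : set nat) :
  enat_sup E = Some d -> forall m, E m -> (m <= d)%N.
Proof.
rewrite /enat_sup; case: pselect => // h [<-] m Em.
have lem : (m < (sval (cid h)).+1)%N by rewrite ltnS; apply: (svalP (cid h)).
by apply: (bigmax_sup (Ordinal lem)) => //; apply/asboolP.
Qed.

(** * Evaluation of polynomials *)

Section PolyEval.
Variables (F : fieldType) (L : comPzRingType) (f : {rmorphism F -> L}).
Variables (n : nat) (t : 'I_n -> L).
Implicit Types (m : {cmonom 'I_n}) (p q : {malg F[{cmonom 'I_n}]}).

Lemma poly_evalEw (d : {fset {cmonom 'I_n}}) p : (msupp p `<=` d)%fset ->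
  poly_eval f t p = \sum_(m <- d) f p@_m * \prod_i t i ^+ m i.
Proof.
move=> le.
have prodE m : \prod_(i <- finsupp m) t i ^+ m i = \prod_i t i ^+ m i.
  rewrite big_uniq ?fset_uniq // [RHS](bigID (mem (finsupp m))) /=.
  rewrite [X in _ = _ * X]big1 ?mulr1 // => i.
  by rewrite -cmE_eq0 => /eqP ->.
rewrite /poly_eval (big_fset_incl _ le) => [|m _ /mcoeff_outdom ->].
  by apply: eq_bigr => m _; rewrite prodE.
by rewrite rmorph0 mul0r.
Qed.

Lemma poly_eval_is_zmod_morphism : zmod_morphism (poly_eval f t).
Proof.
move=> p q; rewrite (poly_evalEw (msuppB_le p q)).
rewrite (poly_evalEw (fsubsetUl (msupp p) (msupp q))).
rewrite (poly_evalEw (fsubsetUr (msupp p) (msupp q))) -sumrB.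
by apply: eq_bigr => m _; rewrite mcoeffB rmorphB mulrBl.
Qed.

HB.instance Definition _ := GRing.isZmodMorphism.Build _ _ (poly_eval f t)
  poly_eval_is_zmod_morphism.

Lemma poly_evalU c m : poly_eval f t << c *g m >> = f c * \prod_i t i ^+ m i.
Proof. by rewrite (poly_evalEw msuppU_le) big_seq_fset1 mcoeffUU. Qed.

End PolyEval.

(** * Derivations and algebraic independence *)

Section PartialDerivative.
Variables (F : fieldType) (n : nat) (i : 'I_n).

(** The division of [m] by ['X_i] truncates when [m i = 0], but the coefficient
    of that term is then zero. *)
Definition pderiv (p : {malg F[{cmonom 'I_n}]}) : {malg F[{cmonom 'I_n}]} :=
  \sum_(m <- msupp p) << p@_m *+ m i *g divcm m (ucm i) >>.

Lemma mcoeff_pderiv p m :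
  (pderiv p)@_m = p@_(mulcm m (ucm i)) *+ (m i).+1.
Proof.
set m' := mulcm m (ucm i).
have m'K : divcm m' (ucm i) = m.
  by apply/eqP/cmP => j; rewrite divcmE mulcmE addnK.
have m'i : m' i = (m i).+1 by rewrite mulcmE ucmE eqxx addn1.
have m'P (k : {cmonom 'I_n}) : (0 < k i)%N -> divcm k (ucm i) = m -> k = m'.
  move=> ki e; apply/esym/eqP/cmP => j; rewrite mulcmE -e divcmE ucmE.
  by case: eqP => [<-|_] /=; rewrite ?subn0 ?addn0 ?subnK.
move: m' m'K m'i m'P => m' m'K m'i m'P.
rewrite /pderiv raddf_sum /=.
transitivity (\sum_(k <- msupp p | k == m') p@_k *+ (m i).+1).
  rewrite [RHS]big_mkcond; apply: eq_bigr => k _; rewrite mcoeffU.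
  case: (eqVneq k m') => [->|kne]; first by rewrite m'K eqxx m'i mulr1n.
  have [->|ki] := posnP (k i); first by rewrite mulr0n mul0rn.
  by case: eqP => [/(m'P k ki)/eqP|_]; [rewrite (negPf kne) | rewrite mulr0n].
have [pm'|pm'] := boolP (m' \in msupp p); last first.
  by rewrite (mcoeff_outdom pm') mul0rn big1 // => k /eqP ->;
    rewrite (mcoeff_outdom pm') mul0rn.
by rewrite -big_filter filter_pred1_uniq ?fset_uniq ?big_seq1.
Qed.

End PartialDerivative.

Definition lin_indep (k : fieldType) (V : lmodType k) (m : nat) (v : 'I_m -> V) :=
  forall c : 'I_m -> k, \sum_i c i *: v i = 0 -> forall i, c i = 0.

Section DerivationIndependence.
Variables (K : fieldType) (A : comPzRingType) (k : fieldType).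
Variables (f : {rmorphism K -> A}) (phi : {rmorphism A -> k}).
Variables (V : lmodType k) (D : A -> V).
Hypothesis DD : forall x y, D (x + y) = D x + D y.
Hypothesis DM : forall x y, D (x * y) = phi x *: D y + phi y *: D x.
Hypothesis Dconst : forall c, D (f c) = 0.
Hypothesis Dker : forall x, phi x = 0 -> D x = 0.
Hypothesis charK : [pchar K] =i pred0.

Lemma derivation0 : D 0 = 0.
Proof. by rewrite -(rmorph0 f) Dconst. Qed.

Lemma derivationX x m : D (x ^+ m) = phi (x ^+ m.-1 *+ m) *: D x.
Proof.
elim: m => [|m IH]; first by rewrite expr0 -(rmorph1 f) Dconst mulr0n rmorph0 scale0r.
rewrite exprS DM IH scalerA -scalerDl -rmorphM -rmorphD; congr (phi _ *: _).
case: m {IH} => [|m] /=; first by rewrite !mulr0n mulr0 add0r.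
by rewrite mulrnAr -exprS -mulrSr.
Qed.

(** As in [pderiv], the truncated subtraction matters only in terms whose
    coefficient [e i] is zero. *)
Lemma derivation_prod n (a : 'I_n -> A) (e : 'I_n -> nat) :
  D (\prod_i a i ^+ e i) =
  \sum_i phi (\prod_j a j ^+ (e j - (i == j)) *+ e i) *: D (a i).
Proof.
have prodD (r : seq 'I_n) : uniq r ->
    D (\prod_(i <- r) a i ^+ e i) =
    \sum_(i <- r) phi (\prod_(j <- r) a j ^+ (e j - (i == j)) *+ e i) *: D (a i).
  elim: r => [|i r IH] /=; first by rewrite !big_nil -(rmorph1 f) Dconst.
  move=> /andP[ir ur]; rewrite !big_cons DM IH // derivationX addrC.
  congr (_ + _).
    rewrite eqxx subn1 scalerA -rmorphM; congr (phi _ *: _).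
    rewrite mulrnAr mulrC; congr (_ * _ *+ _).
    rewrite big_seq [RHS]big_seq; apply: eq_bigr => j jr.
    by rewrite (_ : i == j = false) ?subn0 //; apply: contraNF ir => /eqP ->.
  rewrite scaler_sumr big_seq [RHS]big_seq; apply: eq_bigr => j jr.
  rewrite big_cons (_ : j == i = false); last first.
    by apply: contraNF ir => /eqP <-.
  by rewrite subn0 scalerA -rmorphM mulrnAr.
by have := prodD _ (index_enum_uniq _).
Qed.

Lemma derivation_sum (I : Type) (r : seq I) (G : I -> A) :
  D (\sum_(i <- r) G i) = \sum_(i <- r) D (G i).
Proof. exact: (big_morph D DD derivation0). Qed.

(** The chain rule, for a derivation that kills the constants. *)
Lemma derivation_poly_eval n (a : 'I_n -> A) p :
  D (poly_eval f a p) = \sum_i phi (poly_eval f a (pderiv i p)) *: D (a i).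
Proof.
rewrite (poly_evalEw _ _ (fsubset_refl _)) derivation_sum.
under [RHS]eq_bigr => i _ do
  rewrite /pderiv (raddf_sum (poly_eval f a)) rmorph_sum scaler_suml.
rewrite exchange_big /=; apply: eq_bigr => m _.
rewrite DM Dconst scaler0 addr0 derivation_prod scaler_sumr.
apply: eq_bigr => i _; rewrite scalerA -rmorphM poly_evalU rmorphMn.
rewrite mulrnAr mulrnAl; congr (phi (_ * _ *+ _) *: _).
by apply: eq_bigr => j _; rewrite divcmE ucmE.
Qed.

Lemma rmorph_poly_eval n (a : 'I_n -> A) p :
  poly_eval (phi \o f) (phi \o a) p = phi (poly_eval f a p).
Proof.
rewrite !(poly_evalEw _ _ (fsubset_refl _)) rmorph_sum.
by apply: eq_bigr => m _; rewrite rmorphM rmorph_prod; congr (_ * _);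
  apply: eq_bigr => i _; rewrite rmorphXn.
Qed.

(** Induction on the degree of a relation [p].  As [D] kills the kernel of
    [phi], the chain rule turns [p] into a linear relation between the
    [D (a i)], so each partial derivative of [p] vanishes at the [phi (a i)] and,
    being of smaller degree, is zero.  In characteristic zero [p] is then a
    constant, and a constant with value zero is zero. *)
Lemma alg_independent_of_derivation n (a : 'I_n -> A) :
  lin_indep (D \o a) -> alg_independent (phi \o f) (phi \o a).
Proof.
move=> indep p.
have [N pN] : exists N, forall m, p@_m != 0 -> (mdeg m < N)%N.
  by exists (msize p) => m; rewrite mcoeff_neq0; apply: msize_mdeg_lt.
elim: N p pN => [|N IH] p pN p0.
  by apply/malgP => m; rewrite mcoeff0; apply: contrapT => /eqP /pN.
have charK' := (pcharf0P K).1 charK.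
have dp0 i : pderiv i p = 0.
  apply: IH => [m|].
    rewrite mcoeff_pderiv => pm; have /pN : p@_(mulcm m (ucm i)) != 0.
      by apply: contraNneq pm => ->; rewrite mul0rn.
    by rewrite -[mulcm _ _]/(mmul m (ucm i)) mdegM mdegU addn1.
  rewrite rmorph_poly_eval; move: i; apply: indep.
  by rewrite -derivation_poly_eval Dker // -rmorph_poly_eval.
(* The coefficient of [m / X_i] in the zero polynomial [pderiv i p] is the
   multiple [m i] of the coefficient of [m] in [p]. *)
have pm0 (m : {cmonom 'I_n}) i : m i != 0%N -> p@_m = 0.
  move=> mi; have := congr1 (fun q => q@_(divcm m (ucm i))) (dp0 i).
  rewrite mcoeff0 mcoeff_pderiv (_ : mulcm _ _ = m); last first.
    apply/eqP/cmP => j; rewrite mulcmE divcmE ucmE.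
    by case: eqP => [<-|_]; lia.
  by move/eqP; rewrite -mulr_natr mulf_eq0 charK' orbF => /eqP.
have pC : p = << p@_(onecm 'I_n) *g onecm 'I_n >>.
  apply/malgP => m; rewrite mcoeffU; case: eqP => [<-|m1]; first by rewrite mulr1n.
  rewrite mulr0n; apply: contrapT => pm; apply: m1; apply/esym/eqP/cmP => i.
  by rewrite onecmE; apply: contrapT => /eqP /pm0.
move: p0; rewrite pC poly_evalU big1 ?mulr1 => [/eqP|i _]; last by rewrite onecmE.
by rewrite fmorph_eq0 => /eqP ->; rewrite monalgU0.
Qed.

End DerivationIndependence.

(** A maximal linearly independent family of values of [D] spans all of them:
    adding one more value gives a relation in which its coefficient is nonzero. *)
Lemma finite_spanning_family (A : Type) (k : fieldType) (V : lmodType k)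
    (D : A -> V) (N : nat) :
  (forall m (a : 'I_m -> A), lin_indep (D \o a) -> (m <= N)%N) ->
  exists d (a : 'I_d -> A), (d <= N)%N /\
    forall x, exists c : 'I_d -> k, D x = \sum_i c i *: D (a i).
Proof.
move=> bound; pose P m := `[< exists a : 'I_m -> A, lin_indep (D \o a) >].
have P0 : exists m, P m.
  exists 0%N; apply/asboolP.
  by exists (fun i : 'I_0 => False_rect A (notF (ltn_ord i))) => c _ [].
have PN m : P m -> (m <= N)%N by move=> /asboolP[a]; apply: bound.
case: (ex_maxnP P0 PN) => d /[dup] Pd /asboolP[a indep_a] maxd.
exists d, a; split=> [|x]; first exact: PN.
pose b (i : 'I_d.+1) := if unlift ord0 i is Some j then a j else x.
have [c [eq0 [i ci]]] : exists c : 'I_d.+1 -> k,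
    \sum_i c i *: D (b i) = 0 /\ exists i, c i <> 0.
  apply: contrapT => noc; have /maxd : P d.+1; last by rewrite ltnn.
  apply/asboolP; exists b => c eq0 i; apply: contrapT => ci.
  by apply: noc; exists c; split=> //; exists i.
have b0 : b ord0 = x by rewrite /b unlift_none.
have bS j : b (lift ord0 j) = a j by rewrite /b liftK.
move: eq0; rewrite big_ord_recl b0; under eq_bigr => j _ do rewrite bS.
move=> eq0; have c0 : c ord0 != 0.
  apply/eqP => c0; apply: ci; move: eq0; rewrite c0 scale0r add0r.
  move=> /(indep_a (fun j => c (lift ord0 j))) cS.
  by case: (unliftP ord0 i) => [j ->|->]; [exact: cS | exact: c0].
exists (fun j => - ((c ord0)^-1 * c (lift ord0 j))).
under eq_bigr => j _ do rewrite scaleNr -scalerA.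
rewrite sumrN -scaler_sumr -scalerN; apply: (scalerI c0).
by rewrite scalerA mulfV // scale1r; apply/eqP; rewrite -addr_eq0 eq0.
Qed.

(** * Generators of the cotangent space *)

Lemma quotmod_eq0 (R : comPzRingType) (V : lmodType R) (S : set V) (v : V) :
  S v -> to_quotmod S v = 0.
Proof.
move=> Sv; rewrite -(raddf0 (to_quotmod S)); apply/to_quotmod_eq.
by rewrite subr0; apply: sub_gen_smallest.
Qed.

Lemma scale_to_quotmod (R : comPzRingType) (V : lmodType R) (S : set V) a v :
  a *: to_quotmod S v = to_quotmod S (a *: v).
Proof. by rewrite to_quotmodZ. Qed.

Lemma freemod_span (R : comPzRingType) (X : choiceType)
    (M : set (freemod R X)) :
  is_submod M -> (forall x, M (freemod_gen R x)) -> forall g, M g.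
Proof.
move=> [M0 MP] Mgen g.
have -> : g = \sum_(x <- msupp g) g@_x *: freemod_gen R x.
  rewrite [LHS]monalgE; apply: eq_bigr => x _; apply/malgP => y.
  by rewrite [RHS]freemod_scaleE /freemod_gen !mcoeffU mulrnAr mulr1.
by elim/big_ind: _ => // [x y Mx My|x _];
  [rewrite -[x]scale1r; apply: MP | rewrite -[_ *: _]addr0; apply: MP].
Qed.

Lemma quotmod_span (R : comPzRingType) (X : choiceType)
    (S : set (freemod R X)) (M : set (quotmod S)) :
  is_submod M -> (forall x, M (to_quotmod S (freemod_gen R x))) ->
  forall v, M v.
Proof.
move=> [M0 MP] Mgen v; have [g ->] := to_quotmod_surj v.
apply: (@freemod_span _ _ [set g | M (to_quotmod S g)]%classic) => //.
split=> [|a x y Mx My] /=; first by rewrite raddf0.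
by rewrite raddfD /= -scale_to_quotmod; apply: MP.
Qed.

Section Kaehler.
Variables (K A : comPzRingType) (f : {rmorphism K -> A}).

Lemma kaehler_dD a b : kaehler_d f (a + b) = kaehler_d f a + kaehler_d f b.
Proof.
apply/eqP; rewrite -subr_eq0 opprD addrA -!raddfB; apply/eqP/quotmod_eq0.
by left; left; exists (a, b).
Qed.

Lemma kaehler_dM a b :
  kaehler_d f (a * b) = a *: kaehler_d f b + b *: kaehler_d f a.
Proof.
apply/eqP; rewrite -subr_eq0 opprD addrA !scale_to_quotmod -!raddfB.
by apply/eqP/quotmod_eq0; left; right; exists (a, b).
Qed.

Lemma kaehler_d_const c : kaehler_d f (f c) = 0.
Proof. by apply: quotmod_eq0; right; exists c. Qed.

End Kaehler.

Section BaseChange.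
Variables (A B : comPzRingType) (f : {rmorphism A -> B}) (M : lmodType A).

Lemma to_base_changeD (m m' : M) :
  to_base_change f (m + m') = to_base_change f m + to_base_change f m'.
Proof.
apply/eqP; rewrite -subr_eq0 opprD addrA -!raddfB; apply/eqP/quotmod_eq0.
by left; exists (m, m').
Qed.

Lemma to_base_changeZ a (m : M) :
  to_base_change f (a *: m) = f a *: to_base_change f m.
Proof.
apply/eqP; rewrite -subr_eq0 scale_to_quotmod -raddfB; apply/eqP/quotmod_eq0.
by right; exists (a, m).
Qed.

End BaseChange.

Section CotangentSpace.
Variables (K A B : comPzRingType) (f : {rmorphism K -> A}).
Variable phi : {rmorphism A -> B}.

(** The universal derivation of [A] over [K], with values in the base change to
    [B] of the module of differentials, which is the cotangent space at a point
    when [B] is its residue field. *)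
Definition fiber_d (a : A) : base_change phi (kaehler f) :=
  to_base_change phi (kaehler_d f a).

Lemma fiber_dD a b : fiber_d (a + b) = fiber_d a + fiber_d b.
Proof. by rewrite /fiber_d kaehler_dD to_base_changeD. Qed.

Lemma fiber_dM a b : fiber_d (a * b) = phi a *: fiber_d b + phi b *: fiber_d a.
Proof. by rewrite /fiber_d kaehler_dM to_base_changeD !to_base_changeZ. Qed.

Lemma to_base_change0 : to_base_change phi (0 : kaehler f) = 0.
Proof. by rewrite -(scale0r 0) to_base_changeZ rmorph0 scale0r. Qed.

Lemma fiber_d_const c : fiber_d (f c) = 0.
Proof. by rewrite /fiber_d kaehler_d_const to_base_change0. Qed.

Lemma fiber_d_span (M : set (base_change phi (kaehler f))) :
  is_submod M -> (forall a, M (fiber_d a)) -> forall v, M v.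
Proof.
move=> subM Md v; have [M0 MP] := subM.
pose M' : set (kaehler f) := [set m | M (to_base_change phi m)]%classic.
have subM' : is_submod M'.
  split=> [|a x y Mx My].
    change (M (to_base_change phi (0 : kaehler f))).
    by rewrite to_base_change0.
  change (M (to_base_change phi (a *: x + y))).
  rewrite (to_base_changeD phi (a *: x) y) (to_base_changeZ phi a x).
  exact: (MP _ _ _ Mx My).
apply: (@quotmod_span _ _ (@base_change_rel _ _ phi (kaehler f)) M subM) => m.
exact: (@quotmod_span _ _ (kaehler_rel f) M' subM' Md m).
Qed.

End CotangentSpace.

(** * Counting monomials *)

Section BoundedSupport.
Variables (k : fieldType) (X : choiceType) (E : {fset X}).
Implicit Types (q : {malg k[{cmonom X}]}) (m : {cmonom X}).

(** Only variables of [E] occur, each with degree at most [c].  The bound is per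
    variable rather than on the total degree, so that the monomials allowed
    form a box, which is easy to count. *)
Definition bounded_in (c : nat) q :=
  forall m, q@_m != 0 -> forall v, (m v <= (v \in E) * c)%N.

Lemma bounded_inW c c' q : (c <= c')%N -> bounded_in c q -> bounded_in c' q.
Proof.
by move=> le bq m /bq qm v; apply: leq_trans (qm v) _; rewrite leq_mul.
Qed.

Lemma bounded_inU a m c : (forall v, (m v <= (v \in E) * c)%N) ->
  bounded_in c << a *g m >>.
Proof. by move=> bm m'; rewrite mcoeffU; case: (eqVneq m m') => [<-|]; rewrite ?eqxx. Qed.

Lemma bounded_inD c q q' :
  bounded_in c q -> bounded_in c q' -> bounded_in c (q + q').
Proof.
move=> bq bq' m; rewrite mcoeffD => qm v.
have [qm0|] := eqVneq q@_m 0; last by move=> /bq.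
by apply: bq'; apply: contraNneq qm => q'm0; rewrite qm0 q'm0 addr0.
Qed.

Lemma bounded_inM c c' q q' :
  bounded_in c q -> bounded_in c' q' -> bounded_in (c + c') (q * q').
Proof.
move=> bq bq' m; rewrite mcoeff_neq0 => /msuppM_le[m1 [m2 []]].
rewrite -!mcoeff_neq0 => /bq b1 /bq' b2 -> v.
by rewrite -[mmul _ _]/(mulcm m1 m2) mulcmE mulnDr leq_add.
Qed.

Lemma bounded_in_const a : bounded_in 0 (mconst X a).
Proof. by apply: bounded_inU => v; rewrite onecmE. Qed.

Lemma bounded_in1 : bounded_in 0 1.
Proof. by rewrite -(rmorph1 (mconst X)); apply: bounded_in_const. Qed.

Lemma bounded_inX c q e : bounded_in c q -> bounded_in (c * e) (q ^+ e).
Proof.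
move=> bq; elim: e => [|e IH].
  by rewrite expr0 muln0; apply: bounded_in1.
by rewrite exprS mulnS; apply: bounded_inM.
Qed.

Lemma bounded_in_prod n c (q : 'I_n -> {malg k[{cmonom X}]}) (e : 'I_n -> nat) :
  (forall i, bounded_in c (q i)) ->
  bounded_in (c * \sum_i e i) (\prod_i q i ^+ e i).
Proof.
move=> bq; rewrite big_distrr /=.
elim/big_ind2: _ => [|x p y p' bp bp'|i _]; first exact: bounded_in1.
  exact: bounded_inM.
exact: bounded_inX.
Qed.

Definition cmonom_on (h : X -> nat) : {cmonom X} := [cmonom h v | v in E]%M.

Lemma cmonom_onE h v : cmonom_on h v = if v \in E then h v else 0%N.
Proof. by rewrite cmE fsfun_fun. Qed.

(** With [d] the size of [E], the [N ^ n] products below are bounded by [c * n * N]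
    in each of [d] variables, so they lie in a space of dimension
    [(c * n * N + 1) ^ d].  As [d < n], this is less than [N ^ n] for large [N],
    and the products are then linearly dependent.  The powers of [s] make all of
    them homogeneous of degree [n * N] in the [b i] and [s], which later serves
    to clear denominators. *)
Lemma bounded_in_dependent n c (b : 'I_n -> {malg k[{cmonom X}]}) s :
  (forall i, bounded_in c (b i)) -> bounded_in c s -> (#|` E| < n)%N ->
  exists N (a : {ffun 'I_n -> 'I_N} -> k), (exists e, a e != 0) /\
    \sum_(e : {ffun 'I_n -> 'I_N}) mconst X (a e) *
      (\prod_i b i ^+ e i * s ^+ (n * N - \sum_i e i)) = 0.
Proof.
move=> bb bs ltEn; pose d := #|` E|.
(* This [N] exceeds [(c * n + 1) ^ d], whence
   [(c * n * N + 1) ^ d <= (c * n + 1) ^ d * N ^ d < N ^ d.+1 <= N ^ n]. *)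
pose N := ((c * n).+1 ^ d).+1; pose C := (c * (n * N))%N; exists N.
pose q (e : {ffun 'I_n -> 'I_N}) :=
  \prod_i b i ^+ e i * s ^+ (n * N - \sum_i e i).
have bq e : bounded_in C (q e).
  have le : (\sum_i e i <= n * N)%N.
    rewrite -[n in (n * N)%N]card_ord -sum_nat_const.
    by apply: leq_sum => i _; apply: ltnW.
  rewrite /C -[(n * N)%N](subnKC le) mulnDr.
  by apply: bounded_inM; [apply: bounded_in_prod | apply: bounded_inX].
pose mon (h : {ffun E -> 'I_C.+1}) :=
  cmonom_on (fun v => if insub v is Some w then h w : nat else 0%N).
have monP m : (forall v, (m v <= (v \in E) * C)%N) -> exists h, m = mon h.
  move=> bm; exists [ffun w => inord (m (val w))].
  apply/eqP/cmP => v; rewrite cmonom_onE.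
  have bv := bm v; case: ifPn bv => vE; last by rewrite mul0n leqn0 => /eqP.
  by rewrite mul1n => bv; rewrite insubT ffunE inordK.
(* The coefficients of the products; a linear dependence is a nonzero vector in
   the kernel of [G] acting on rows. *)
pose G : 'M_(#|{ffun 'I_n -> 'I_N}|, #|{ffun E -> 'I_C.+1}|) :=
  \matrix_(i, j) (q (enum_val i))@_(mon (enum_val j)).
have : kermx G != 0.
  rewrite kermx_eq0 /row_free; apply/eqP => rG.
  have := rank_leq_col G; rewrite rG !card_ffun !card_ord -cardfE -/d.
  apply/negP; rewrite -ltnNge.
  apply: (@leq_ltn_trans (((c * n).+1 * N) ^ d)%N).
    have [->//|d0] := posnP d; rewrite leq_exp2r // /C mulnA mulSn.
    by rewrite -add1n leq_add2r.
  rewrite expnMn; apply: (@leq_trans (N ^ d.+1)%N).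
    by rewrite expnS ltn_pmul2r ?expn_gt0.
  by rewrite leq_exp2l // ltnS expn_gt0.
move=> /matrix0Pn[i0 [j0 Kij]].
exists (fun e => kermx G i0 (enum_rank e)); split.
  by exists (enum_val j0); rewrite enum_valK.
apply/malgP => m; rewrite mcoeff0 raddf_sum /=.
under eq_bigr => e _ do rewrite mcoeffCM.
have [bm|nbm] := pselect (forall v, (m v <= (v \in E) * C)%N); last first.
  apply: big1 => e _; apply/eqP; rewrite mulf_eq0; apply/orP; right.
  by apply/eqP; apply: contrapT => /eqP /bq.
have [h ->] := monP m bm.
have KG0 := congr1 (fun M : 'M_(_, _) => M i0 (enum_rank h)) (mulmx_ker G).
transitivity ((kermx G *m G) i0 (enum_rank h)); last by rewrite KG0 mxE.
rewrite mxE [RHS](reindex enum_rank) /=; last first.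
  by apply: onW_bij; apply: enum_rank_bij.
by apply: eq_bigr => e _; rewrite [G _ _]mxE !enum_rankK.
Qed.

End BoundedSupport.

Section LocalizationBound.
Variables (k : fieldType) (X : choiceType) (E : {fset X}).
Variables (B : comPzRingType) (phi : {rmorphism {malg k[{cmonom X}]} -> B}).
Variables (S : mulset B) (g : {rmorphism k -> loc S}).
Hypothesis gE : forall a, g a = to_loc S (phi (mconst X a)).
Hypothesis genB : forall x, exists c q, bounded_in E c q /\ x = phi q.

Lemma to_loc_inv s : S s -> exists y, to_loc S s * y = 1.
Proof.
move=> Ss; exists (Defs.frac 1 Ss).
rewrite -[LHS]/(loc_mul (to_loc S s) (Defs.frac 1 Ss)) loc_mulE.
by apply: eq_frac; ring.
Qed.

Lemma common_denominator n (t : 'I_n -> loc S) :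
  exists s (b : 'I_n -> B), S s /\ forall i, t i * to_loc S s = to_loc S (b i).
Proof.
have frac_den i : t i * to_loc S (den (t i)) = to_loc S (num (t i)).
  rewrite -{1}[t i]frac_num_den.
  rewrite -[LHS]/(loc_mul (Defs.frac _ (denP _)) (to_loc S _)) loc_mulE.
  by apply: eq_frac; ring.
exists (\prod_i den (t i)).
exists (fun i => num (t i) * \prod_(j | j != i) den (t j)); split=> [|i].
  elim/big_ind: _ => [|x y|i _]; [exact: mulset1 | exact: mulsetM | exact: denP].
by rewrite (bigD1 i) //= !rmorphM mulrA frac_den.
Qed.

(** Write the family with a common denominator [s] and lift its numerators and
    [s] to bounded polynomials.  A linear dependence between the products of
    these lifts, divided by a power of [s], is a polynomial relation between the
    members of the family. *)
Lemma alg_independent_loc n (t : 'I_n -> loc S) :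
  alg_independent g t -> (n <= #|` E|)%N.
Proof.
move=> indep; rewrite leqNgt; apply/negP => ltEn.
have [s [b [Ss tb]]] := common_denominator t.
have [c0 [s' [bs' sE]]] := genB s.
have /choice[cq cqP] : forall i, exists cq : nat * {malg k[{cmonom X}]},
    bounded_in E cq.1 cq.2 /\ b i = phi cq.2.
  by move=> i; have [c [q [bq e]]] := genB (b i); exists (c, q).
pose c := (c0 + \sum_i (cq i).1)%N.
have bb i : bounded_in E c (cq i).2.
  apply: bounded_inW (cqP i).1.
  by rewrite /c (bigD1 i) //= addnCA leq_addr.
have bs : bounded_in E c s' by apply: bounded_inW bs'; apply: leq_addr.
have [N [a [[e0 ae0] eq0]]] := bounded_in_dependent bb bs ltEn.
pose mon (e : {ffun 'I_n -> 'I_N}) :=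
  cmonom_on [fset i in enum 'I_n]%fset (fun i => e i).
have monE e i : mon e i = e i.
  by rewrite cmonom_onE in_fset /= mem_enum.
have mon_inj : injective mon.
  by move=> e e' ee'; apply/ffunP => i; apply/val_inj; rewrite /= -!monE ee'.
pose p : {malg k[{cmonom 'I_n}]} := \sum_e << a e *g mon e >>.
have /indep p0 : poly_eval g t p = 0.
  have [y sy] := to_loc_inv Ss.
  suff sp : poly_eval g t p * to_loc S s ^+ (n * N) = 0.
    rewrite -[LHS]mulr1 -(expr1n _ (n * N)) -sy exprMn mulrA sp.
    by rewrite mul0r.
  rewrite /p (raddf_sum (poly_eval g t)) /= mulr_suml.
  rewrite -[RHS](rmorph0 (to_loc S)) -(rmorph0 phi) -eq0 !rmorph_sum.
  apply: eq_bigr => e _; rewrite poly_evalU gE !rmorphM -mulrA.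
  congr (_ * _); rewrite !rmorph_prod rmorphXn rmorphXn -sE.
  have le : (\sum_i e i <= n * N)%N.
    rewrite -[n in (n * N)%N]card_ord -sum_nat_const.
    by apply: leq_sum => i _; apply: ltnW.
  rewrite -[X in to_loc S s ^+ X](subnKC le) exprD mulrA; congr (_ * _).
  rewrite -prodrXr -big_split /=; apply: eq_bigr => i _.
  by rewrite monE -exprMn tb !rmorphXn -(cqP i).2.
have p_e0 : p@_(mon e0) = a e0.
  rewrite raddf_sum /= (bigD1 e0) //= [X in _ + X]big1 => [|e ne].
    by rewrite addr0 mcoeffUU.
  by rewrite mcoeffU (inj_eq mon_inj) (negPf ne) mulr0n.
by move/eqP: ae0; apply; rewrite -p_e0 p0 mcoeff0.
Qed.

End LocalizationBound.

(** * Symmetric algebras *)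

Section SymmetricAlgebraGenerators.
Variables (k : fieldType) (M : lmodType k) (d : nat) (e : 'I_d -> M).
Hypothesis span_e : forall v, exists c : 'I_d -> k, v = \sum_i c i *: e i.

Let E : {fset M} := [fset e i | i in 'I_d]%fset.

Lemma to_symD (v w : M) : to_sym (v + w) = to_sym v + to_sym w.
Proof.
rewrite /to_sym -raddfD; apply/to_quotring_eq; rewrite opprD addrA.
by apply: sub_gen_smallest; left; exists (v, w).
Qed.

Lemma to_symZ a (v : M) : to_sym (a *: v) = sym_const M a * to_sym v.
Proof.
rewrite /to_sym /= -rmorphM; apply/to_quotring_eq.
by apply: sub_gen_smallest; right; exists (a, v).
Qed.

Lemma to_sym0 : to_sym (0 : M) = 0.
Proof. by rewrite -(scale0r (0 : M)) to_symZ rmorph0 mul0r. Qed.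

Definition represented (x : sym M) : Prop :=
  exists c q, bounded_in E c q /\ x = to_quotring (@sym_rel k M) q.

Lemma representedD x y : represented x -> represented y -> represented (x + y).
Proof.
move=> [c [q [bq ->]]] [c' [q' [bq' ->]]]; exists (c + c')%N, (q + q').
split; last by rewrite raddfD.
apply: bounded_inD; first exact: bounded_inW (leq_addr _ _) bq.
exact: bounded_inW (leq_addl _ _) bq'.
Qed.

Lemma representedM x y : represented x -> represented y -> represented (x * y).
Proof.
move=> [c [q [bq ->]]] [c' [q' [bq' ->]]]; exists (c + c')%N, (q * q').
by split; [apply: bounded_inM | rewrite rmorphM].
Qed.

Lemma represented_const a : represented (sym_const M a).
Proof. by exists 0%N, (mconst M a); split=> //; apply: bounded_in_const. Qed.

Lemma represented0 : represented 0.
Proof. by rewrite -(rmorph0 (sym_const M)); apply: represented_const. Qed.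

Lemma represented_vector v : represented (to_sym v).
Proof.
have [c ->] := span_e v; rewrite (big_morph _ to_symD to_sym0).
elim/big_ind: _ => [||i _]; [exact: represented0 | exact: representedD |].
rewrite to_symZ; apply: representedM; first exact: represented_const.
exists 1%N, (mvar k (e i)); split=> //; apply: bounded_inU => v'.
rewrite ucmE; case: eqP => [<-|//].
by rewrite (_ : e i \in E) //; apply/imfsetP; exists i.
Qed.

(** Since [to_sym] is linear, the variable of any vector can be replaced by a
    linear combination of the variables of the [e i]. *)
Lemma represented_all x : represented x.
Proof.
have [q ->] := to_quotring_surj x; rewrite [q]monalgE raddf_sum /=.
elim/big_ind: _ => [||m _]; [exact: represented0 | exact: representedD |].
move: (q@_m) => a; have [N] := ubnP (mdeg m).
elim: N m => // N IH m; rewrite ltnS => mN.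
have [m1|] := eqVneq m (onecm M).
  by rewrite m1; apply: represented_const.
rewrite -mdeg_eq0 => m1; have [v mv] : exists v, m v != 0%N.
  apply: contrapT => nov; case/eqP: m1; rewrite mdegE big1 // => v _.
  by apply: contrapT => /eqP mv; apply: nov; exists v.
pose m' := divcm m (ucm v); have mE : m = mulcm m' (ucm v).
  apply/eqP/cmP => w; rewrite mulcmE divcmE ucmE.
  by case: (eqVneq v w) => [<-|_]; lia.
have -> : << a *g m >> = << a *g m' >> * mvar k v.
  by rewrite mE; symmetry; rewrite -[in RHS](mulr1 a); apply: fgmulUU.
rewrite rmorphM; apply: representedM; last exact: represented_vector.
apply: IH; apply: leq_trans mN.
by rewrite mE -[mulcm _ _]/(mmul m' (ucm v)) mdegM mdegU addn1.
Qed.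

Lemma alg_independent_sym_loc (S : mulset (sym M)) n (t : 'I_n -> loc S) :
  alg_independent (to_loc S \o sym_const M) t -> (n <= d)%N.
Proof.
move=> indep.
apply: (leq_trans (@alg_independent_loc k M E (sym M)
  (to_quotring (@sym_rel k M)) S (to_loc S \o sym_const M) _ represented_all
  n t indep)) => //.
by apply: leq_trans (leq_imfset_card _ _ _) _; rewrite -cardE card_ord.
Qed.

End SymmetricAlgebraGenerators.

(** * Dimension of the tangent fiber *)

Lemma to_residue_eq0 (A : comPzRingType) (P : spec A) (x : A) :
  to_residue P x = 0 <-> P x.
Proof.
rewrite -to_resdom_eq0 /to_residue /=; split=> [/eqP | ->].
  by rewrite tofrac_eq0 => /eqP.
exact: rmorph0.
Qed.

(** The cotangent space is spanned by at most [d] differentials, so its symmetric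
    algebra has transcendence degree at most [d].  The reducedness hypothesis
    enters in showing that the differentials of elements of [P] vanish. *)
Lemma trdeg_tangent_fiber (K : fieldType) (A : comPzRingType)
    (f : {rmorphism K -> A}) (P : spec A) (d n : nat)
    (S : mulset (tangent_fiber f P)) (t : 'I_n -> loc S) :
  [pchar K] =i pred0 ->
  (forall p, P p -> exists2 s, ~ P s & s * p = 0) ->
  dim_at f P = Some d ->
  alg_independent (to_loc S \o tangent_fiber_const f P) t -> (n <= d)%N.
Proof.
move=> charK redP dimP.
pose D := fiber_d f (to_residue P).
(* If [s * x = 0] with [s] outside [P], then [0 = D (s * x) = s *: D x], where
   [s] is invertible in the residue field. *)
have Dker x : to_residue P x = 0 -> D x = 0.
  move=> /to_residue_eq0 Px; have [s Ps sx] := redP x Px.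
  have := fiber_dM f (to_residue P) s x.
  rewrite sx ((to_residue_eq0 P x).2 Px) scale0r addr0.
  rewrite -(rmorph0 f) fiber_d_const => /esym/eqP; rewrite scaler_eq0.
  by case/orP=> /eqP // /to_residue_eq0.
have [d' [a [led' spanD]]] : exists d' (a : 'I_d' -> A), (d' <= d)%N /\
    forall x, exists c : 'I_d' -> residue_field P, D x = \sum_i c i *: D (a i).
  apply: finite_spanning_family => m a indep.
  apply: (enat_sup_some dimP); exists (to_residue P \o a).
  exact: (alg_independent_of_derivation (fiber_dD f (to_residue P))
    (fiber_dM f (to_residue P)) (fiber_d_const f (to_residue P)) Dker charK).
move=> indep; apply: leq_trans led'.
apply: (alg_independent_sym_loc (e := D \o a)) indep.
pose M : set (base_change (to_residue P) (kaehler f)) :=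
  [set v | exists c : 'I_d' -> residue_field P, v = \sum_i c i *: D (a i)]%classic.
apply: (@fiber_d_span _ _ _ _ _ M) => //.
split=> [|b x y [c ->] [c' ->]].
  by exists (fun=> 0); rewrite big1 // => i _; rewrite scale0r.
exists (fun i => b * c i + c' i); rewrite scaler_sumr -big_split /=.
by apply: eq_bigr => i _; rewrite scalerDl scalerA.
Qed.

Theorem corollary1p5 (K : fieldType) (delta : K -> K) (n : nat)
    (u : 'I_n -> diffpoly K n)
    (Sigma1 : set (spec (diffquot delta u))) (eta1 : spec (diffquot delta u)) :
  is_derivation delta ->
  [pchar K] =i pred0 ->
  irreducible_component Sigma1 ->
  generic_point Sigma1 eta1 ->
  enat_lt (dim_at (diffquot_const delta u) eta1) infty ->
  enat_lt (dim_at (diffquot_const delta u) eta1)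
          (dim_tangent_fiber (diffquot_const delta u) eta1) ->
  ~ generically_reduced Sigma1.
Proof.
move=> _ charK compS genS; case dimE: (dim_at _ _) => [d|] // _.
move=> /enat_lt_sup[m [t indep] ltdm] /(_ _ genS) redP.
have minP := minimal_prime_of_component compS genS.
have ledm := trdeg_tangent_fiber charK (reduced_minimal_prime minP redP) dimE indep.
by move: ltdm; rewrite ltnNge ledm.
Qed.
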